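(* Let $\bm{A}=[\bm{A}_1\ \bm{A}_2]\in\mathbb{R}^{m\times(n_1+n_2)}$ have full column rank with $\bm{A}_1^\top\bm{A}_1=\bm{I}_{n_1}$, $\bm{A}_2^\top\bm{A}_2=\bm{I}_{n_2}$, and $\bm{C}:=\bm{A}_2^\top\bm{A}_1\neq0$, with $r:=\operatorname{rank}(\bm{C})$. Let $\rho_{\mathrm{BGD}}^*:=\min_{\gamma_1>0,\gamma_2>0}\rho(\bm{M}(\gamma_1,\gamma_2))$. (i) If $r=\min\{n_1,n_2\}$, then $\rho_{\mathrm{BGD}}^*=\dfrac{\sqrt{1-\lambda_r(\bm{C}\bm{C}^\top)}-\sqrt{1-\lambda_1(\bm{C}\bm{C}^\top)}}{\sqrt{1-\lambda_r(\bm{C}\bm{C}^\top)}+\sqrt{1-\lambda_1(\bm{C}\bm{C}^\top)}}$. (ii) If $r<\min\{n_1,n_2\}$, then $\rho_{\mathrm{BGD}}^*=\dfrac{1-\sqrt{1-\lambda_1(\bm{C}\bm{C}^\top)}}{1+\sqrt{1-\lambda_1(\bm{C}\bm{C}^\top)}}$, attained at $\gamma_1=\gamma_2=\dfrac{2}{1+\sqrt{1-\lambda_1(\bm{C}\bm{C}^\top)}}$.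
   Context: $\lambda_i(\cdot)$ denotes the $i$-th largest eigenvalue of a symmetric matrix; $\rho(\cdot)$ is the spectral radius. For $\gamma_1,\gamma_2>0$, $\bm{M}(\gamma_1,\gamma_2):=\left(\bm{I}-\begin{bmatrix}0&0\\ \gamma_2\bm{A}_2^\top\bm{A}_1&\gamma_2\bm{A}_2^\top\bm{A}_2\end{bmatrix}\right)\left(\bm{I}-\begin{bmatrix}\gamma_1\bm{A}_1^\top\bm{A}_1&\gamma_1\bm{A}_1^\top\bm{A}_2\\0&0\end{bmatrix}\right)$, the iteration matrix of two-block gradient descent with stepsizes $\gamma_1,\gamma_2$ on $\frac12\|\bm{A}\bm{x}-\bm{y}\|_2^2$. *)

(* Defs.v *)
From HB Require Import structures.
From mathcomp Require Import all_boot all_order all_algebra.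
From mathcomp Require Import complex.
Set Implicit Arguments. Unset Strict Implicit. Unset Printing Implicit Defensive.
Import Order.TTheory GRing.Theory Num.Theory.
Local Open Scope ring_scope.

Definition cmx (R : rcfType) (n : nat) (M : 'M[R]_n) : 'M[R[i]]_n :=
  map_mx (fun x => (x%:C)%C) M.

(* The complex eigenvalues of a real square matrix, listed with algebraic
   multiplicity: the roots of its characteristic polynomial over R[i]. *)
Definition eigs (R : rcfType) (n : nat) (M : 'M[R]_n) : seq R[i] :=
  sval (closed_field_poly_normal (char_poly (cmx M))).

Definition cmod (R : rcfType) (z : R[i]) : R :=
  Num.sqrt (complex.Re z ^+ 2 + complex.Im z ^+ 2).

Definition spectral_radius (R : rcfType) (n : nat) (M : 'M[R]_n) : R :=
  \big[Num.max/0]_(z <- eigs M) cmod z.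

(* Eigenvalues of a (symmetric) real matrix in non-increasing order, with
   multiplicity; for symmetric matrices all eigenvalues are real, so taking
   real parts loses nothing.  lambda_ i M is the i-th largest (1-based). *)
Definition eigs_desc (R : rcfType) (n : nat) (M : 'M[R]_n) : seq R :=
  sort (fun x y => y <= x) (map (@complex.Re R) (eigs M)).

Definition lambda_ (R : rcfType) (n : nat) (i : nat) (M : 'M[R]_n) : R :=
  nth 0 (eigs_desc M) i.-1.

(* Iteration matrix of two-block gradient descent with stepsizes g1, g2. *)
Definition BGD_M (R : rcfType) (m n1 n2 : nat)
  (A1 : 'M[R]_(m, n1)) (A2 : 'M[R]_(m, n2)) (g1 g2 : R) : 'M[R]_(n1 + n2) :=
  (1%:M - block_mx 0 0 (g2 *: (A2^T *m A1)) (g2 *: (A2^T *m A2)))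
  *m (1%:M - block_mx (g1 *: (A1^T *m A1)) (g1 *: (A1^T *m A2)) 0 0).

Definition is_min_pos (R : rcfType) (f : R -> R -> R) (v : R) : Prop :=
  (exists g1 g2, 0 < g1 /\ 0 < g2 /\ f g1 g2 = v) /\
  (forall g1 g2, 0 < g1 -> 0 < g2 -> v <= f g1 g2).

(* Main.v *)
(* Write a = 1 - g1, b = 1 - g2, u = g1 g2 = (1 - a)(1 - b).  A row eigenvector
   (w1, w2) of the iteration matrix for the eigenvalue z satisfies
     (z - a)(z - b) w2 = u z w2 C C^T,
   so every eigenvalue is a root of q_s(z) = (z - a)(z - b) - u s z for some
   nonzero eigenvalue s of C C^T, or is 0, a (only when rank C < n1) or
   b (only when rank C < n2).

   Lower bound: if all roots of q_s lie in the disk of radius rho < 1, then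
   q_s(1) = u (1 - s) lies between (1 - rho)^2 and (1 + rho)^2.  Using the left
   inequality for the largest s and the right one for the smallest s (s = 0 in
   the rank-deficient case) eliminates u and bounds rho from below.

   Upper bound: with al = sqrt (1 - s_min), be = sqrt (1 - s_max) and
   rho = (al - be) / (al + be), choose u = 4 / (al + be)^2 and a b = rho^2.
   Then |a + b + u s| <= 2 rho for all relevant s, which puts every root of q_s
   on the circle of radius rho.  Since a b = rho^2, one of a, b lies in the disk,
   which suffices when rank C = min(n1, n2); in the rank-deficient case al = 1
   and a = b = -rho. *)
Require Import Defs.
From HB Require Import structures.
From mathcomp Require Import all_boot all_order all_algebra.
From mathcomp Require Import complex.
From mathcomp Require Import ring lra.
Import Order.TTheory GRing.Theory Num.Theory.
Local Open Scope ring_scope.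

(** * Ranks, kernels and normal matrices *)

Lemma mxrank_diag (F : fieldType) (n : nat) (d : 'rV[F]_n) :
  \rank (diag_mx d) = (\sum_i (d 0%R i != 0%R))%N.
Proof.
elim: n d => [|n IHn] d; first by rewrite big_ord0 thinmx0 mxrank0.
rewrite -(@hsubmxK _ _ 1 n d); set l := lsubmx _; set r := rsubmx _.
have /= -> := diag_mx_row l r; have /= -> := rank_diag_block_mx (diag_mx l) (diag_mx r).
rewrite IHn (@big_split_ord _ _ _ 1 n) /= big_ord1.
congr (_ + _)%N; last by apply: eq_bigr => i _; have /= -> := row_mxEr l r 0 i.
have /= -> := row_mxEl l r 0 0; have -> : diag_mx l = l.
  by apply/matrixP => i j; rewrite !ord1 !mxE eqxx mulr1n.
rewrite rank_rV; congr (nat_of_bool (~~ _)).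
apply/eqP/eqP => [->|d0]; first by rewrite mxE.
by apply/rowP => j; rewrite ord1 d0 mxE.
Qed.

Section Conjugate_transpose.
Local Open Scope sesquilinear_scope.

Lemma mulmx_ctr_ge0 (K : numClosedFieldType) (n : nat) (v : 'rV[K]_n) :
  0 <= (v *m v^t*) 0 0.
Proof.
rewrite mxE sumr_ge0 // => i _; rewrite !mxE; exact: mul_conjC_ge0.
Qed.

Lemma mulmx_ctr_gt0 (K : numClosedFieldType) (n : nat) (v : 'rV[K]_n) :
  v != 0 -> 0 < (v *m v^t*) 0 0.
Proof.
move=> v0; rewrite lt_neqAle mulmx_ctr_ge0 andbT.
apply: contra_neq v0 => /esym/eqP.
rewrite mxE psumr_eq0 => [/allP v0|i _]; last by rewrite !mxE mul_conjC_ge0.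
apply/rowP => i; have := v0 i (mem_index_enum i).
by rewrite !mxE mul_conjC_eq0 => /eqP.
Qed.

(** Pairing v C C^* with v gives the squared norm of v C. *)
Lemma mulmx_ctr_eq0 (K : numClosedFieldType) (m n : nat)
  (v : 'rV[K]_m) (C : 'M[K]_(m, n)) :
  (v *m (C *m C^t*) == 0) = (v *m C == 0).
Proof.
apply/eqP/eqP => [vCC|vC]; last by rewrite mulmxA vC mul0mx.
apply/eqP; apply: contraTT isT => /mulmx_ctr_gt0.
by rewrite trmx_mul map_mxM mulmxA -(mulmxA v) vCC mul0mx mxE ltxx.
Qed.

(** Both matrices have the same left kernel, hence the same rank by rank-nullity. *)
Lemma mxrank_mul_ctr (K : numClosedFieldType) (m n : nat) (C : 'M[K]_(m, n)) :
  \rank (C *m C^t*) = \rank C.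
Proof.
have eqk : (kermx (C *m C^t*) :=: kermx C)%MS.
  apply/eqmxP/rV_eqP => v; apply/sub_kermxP/sub_kermxP => /eqP.
    by rewrite mulmx_ctr_eq0 => /eqP.
  by rewrite -mulmx_ctr_eq0 => /eqP.
have := eqk.1; rewrite !mxrank_ker => E.
by rewrite -(subKn (rank_leq_row (C *m C^t*))) E subKn ?rank_leq_row.
Qed.

Lemma ker_neq0 (F : fieldType) (m n : nat) (C : 'M[F]_(m, n)) :
  (\rank C < m)%N -> exists2 v : 'rV_m, v != 0 & v *m C = 0.
Proof.
move=> rC; have /rowV0Pn[v /sub_kermxP vC v0] : kermx C != 0.
  by rewrite -mxrank_eq0 mxrank_ker subn_eq0 -ltnNge.
by exists v.
Qed.

Lemma ker_rank_lt (F : fieldType) (m n : nat) (C : 'M[F]_(m, n)) (v : 'rV_m) :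
  v != 0 -> v *m C = 0 -> (\rank C < m)%N.
Proof.
move=> v0 vC; rewrite ltn_neqAle rank_leq_row andbT.
apply: contra v0 => fC; apply/eqP/(row_free_inj fC); rewrite /= vC mul0mx //.
Qed.

Lemma char_poly_simmx (F : fieldType) (n : nat) (P A : 'M[F]_n) :
  P \in unitmx -> char_poly (invmx P *m A *m P) = char_poly A.
Proof.
move=> uP; rewrite /char_poly /char_poly_mx.
have PV : map_mx polyC (invmx P) *m map_mx polyC P = 1%:M :> 'M_n.
  by rewrite -map_mxM mulVmx // map_mx1.
transitivity (\det (map_mx polyC (invmx P) *m ('X%:M - map_mx polyC A) *m map_mx polyC P)).
  by rewrite mulmxBr mulmxBl scalar_mxC -(mulmxA 'X%:M) PV mulmx1 -!map_mxM.
by rewrite !det_mulmx mulrC mulrA -det_mulmx (mulmx1C PV) det1 mul1r.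
Qed.

Lemma char_poly_normal (K : numClosedFieldType) (n : nat) (A : 'M[K]_n) :
  A \is normalmx ->
  char_poly A = \prod_(i < n) ('X - (spectral_diag A 0 i)%:P).
Proof.
move=> /orthomx_spectralP nA.
rewrite {1}nA char_poly_simmx ?spectral_unit // char_poly_trig.
  by apply: eq_bigr => i _; rewrite mxE eqxx.
by apply: diag_mx_is_trig.
Qed.

Lemma mxrank_normal (K : numClosedFieldType) (n : nat) (A : 'M[K]_n) :
  A \is normalmx -> \rank A = (\sum_i (spectral_diag A 0%R i != 0%R))%N.
Proof.
move=> /orthomx_spectralP nA.
rewrite {1}nA mxrankMfree ?row_free_unit ?spectral_unit //.
rewrite -mxrank_tr trmx_mul mxrankMfree
  ?row_free_unit ?unitmx_tr ?unitmx_inv ?spectral_unit //.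
by rewrite mxrank_tr mxrank_diag.
Qed.

(** * Complex eigenvalues and the spectral radius of real matrices *)

Lemma eigsE (R : rcfType) (n : nat) (M : 'M[R]_n) (z : R[i]) :
  (z \in eigs M) = eigenvalue (cmx M) z.
Proof.
rewrite /eigs eigenvalue_root_char; case: closed_field_poly_normal => /= s ->.
by rewrite (monicP (char_poly_monic _)) scale1r root_prod_XsubC.
Qed.

Lemma cmodE (R : rcfType) (z : R[i]) : ((cmod z)%:C)%C = `|z|.
Proof. by rewrite normc_def. Qed.

Lemma spectral_radius_ge (R : rcfType) (n : nat) (M : 'M[R]_n) (z : R[i]) :
  eigenvalue (cmx M) z -> `|z| <= ((spectral_radius M)%:C)%C.
Proof.
rewrite -eigsE -cmodE lecR => zM; exact: le_bigmax_seq.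
Qed.

Lemma spectral_radius_ge0 (R : rcfType) (n : nat) (M : 'M[R]_n) :
  0 <= spectral_radius M.
Proof. exact: bigmax_ge_id. Qed.

Lemma spectral_radius_le (R : rcfType) (n : nat) (M : 'M[R]_n) (rho : R) :
  0 <= rho -> (forall z, eigenvalue (cmx M) z -> `|z| <= (rho%:C)%C) ->
  spectral_radius M <= rho.
Proof.
move=> rho0 zM; rewrite /spectral_radius big_seq; apply: bigmax_le => // z z_eig.
by rewrite -lecR cmodE zM // -eigsE.
Qed.

Lemma trC_cmx (R : rcfType) (m n : nat) (A : 'M[R]_(m, n)) :
  (map_mx (real_complex R) A)^t* = map_mx (real_complex R) A^T.
Proof.
apply/matrixP => i j; rewrite !mxE; apply/CrealP/complex_realP; by exists (A j i).
Qed.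

(** * The spectrum of the Gram matrix C C^T *)

Lemma gram_normal (R : rcfType) (m n : nat) (C : 'M[R]_(m, n)) :
  cmx (C *m C^T) \is normalmx.
Proof.
by apply/normalmxP; rewrite trC_cmx trmx_mul trmxK.
Qed.

Lemma cmx_gram (R : rcfType) (m n : nat) (C : 'M[R]_(m, n))
  (D := map_mx (real_complex R) C) : cmx (C *m C^T) = D *m D^t*.
Proof. by rewrite trC_cmx -map_mxM. Qed.

(** Two factorizations into monic linear factors agree up to order. This replaces the opaque root
    list [eigs] by the spectral diagonal, whose nonzero entries are counted by the rank. *)
Lemma perm_eigs_normal (R : rcfType) (n : nat) (M : 'M[R]_n) :
  cmx M \is normalmx ->
  perm_eq (eigs M) [seq spectral_diag (cmx M) 0 i | i <- enum 'I_n].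
Proof.
move=> nM; apply: prod_XsubC_eq; rewrite big_map big_enum /= -char_poly_normal //.
rewrite /eigs; case: closed_field_poly_normal => /= s ->.
by rewrite (monicP (char_poly_monic _)) scale1r.
Qed.

(** If v C C^T = s v, then the squared norm of v C is s times that of v. *)
Lemma gram_eigenvalue_ge0 (R : rcfType) (m n : nat) (C : 'M[R]_(m, n)) (s : R[i]) :
  eigenvalue (cmx (C *m C^T)) s -> 0 <= s.
Proof.
case/eigenvalueP => v; rewrite cmx_gram; set D := map_mx _ _ => vs v0.
have := mulmx_ctr_ge0 _ _ (v *m D).
rewrite trmx_mul map_mxM mulmxA -(mulmxA v) vs -scalemxAl mxE.
by rewrite pmulr_lge0 // mulmx_ctr_gt0.
Qed.

Lemma count_eigs_gram (R : rcfType) (m n : nat) (C : 'M[R]_(m, n)) :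
  count (fun z => z != 0) (eigs (C *m C^T)) = \rank C.
Proof.
have nG := gram_normal _ _ _ C.
rewrite (permP (perm_eigs_normal _ _ _ nG)) count_map -sum1_count big_enum_cond /=.
rewrite -(mxrank_map (real_complex R) C) -mxrank_mul_ctr -cmx_gram mxrank_normal //.
by rewrite big_mkcond; apply: eq_bigr => i _ /=; case: eqP.
Qed.

Section Eigs_desc_gram.
Variables (R : rcfType) (m n : nat) (C : 'M[R]_(m, n)).
Let L := eigs_desc (C *m C^T).

(** Gram eigenvalues are real, so the real parts stored in [eigs_desc] are the eigenvalues
    themselves. *)
Lemma mem_eigs_desc_gram x :
  (x \in L) = eigenvalue (cmx (C *m C^T)) (x%:C)%C.
Proof.
rewrite mem_sort -eigsE; apply/mapP/idP => [[z zE ->]|xE]; last by exists (x%:C)%C.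
by rewrite RRe_real // ger0_real // (gram_eigenvalue_ge0 _ _ _ C) // -eigsE.
Qed.

Lemma count_eigs_desc_gram : count (fun x => 0 < x) L = \rank C.
Proof.
rewrite /L /eigs_desc (permP (permEl (perm_sort _ _))) count_map -count_eigs_gram.
apply: eq_in_count => z; rewrite eigsE => /gram_eigenvalue_ge0 z0 /=.
have := RRe_real (ger0_real z0); case: z z0 => x y /= z0 [y0]; subst y.
by rewrite ler0c in z0; rewrite lt_neqAle z0 andbT eq_sym -(inj_eq (@complexI R)).
Qed.

Lemma eigs_desc_sorted : sorted >=%R L.
Proof. by apply: sort_sorted => x y; exact: le_total. Qed.

Hypothesis C0 : C != 0.

Let rC : (0 < \rank C)%N. Proof. by rewrite lt0n mxrank_eq0. Qed.

Let r_le : (\rank C <= size L)%N.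
Proof. by rewrite -count_eigs_desc_gram count_size. Qed.

Let ge_tr : transitive (>=%R : rel R).
Proof. by move=> x y z xy yz; exact: le_trans yz xy. Qed.

Lemma lambda1_mem : lambda_ 1 (C *m C^T) \in L.
Proof. by apply: mem_nth; apply: leq_trans r_le. Qed.

Lemma lambda1_max x : x \in L -> x <= lambda_ 1 (C *m C^T).
Proof.
move=> xL; rewrite /lambda_ /=; have sL := eigs_desc_sorted.
rewrite -[x](nth_index 0 xL).
by apply: (sorted_leq_nth ge_tr (fun x => lexx x) 0 sL) => //;
  by rewrite inE ?index_mem // (leq_trans rC).
Qed.

(** The list is non-increasing and has exactly [\rank C] positive entries, counted with
    multiplicity, so they fill its first [\rank C] positions. *)
Let nth_gt0 k : (k < size L)%N -> (0 < nth 0 L k) = (k < \rank C)%N.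
Proof.
move=> kL; have sL := eigs_desc_sorted; rewrite -count_eigs_desc_gram.
have sorted_le i j : (i <= j)%N -> (j < size L)%N -> nth 0 L j <= nth 0 L i.
  move=> ij jL; apply: (sorted_leq_nth ge_tr (fun x => lexx x) 0 sL) => //.
  by rewrite inE (leq_ltn_trans ij).
rewrite -[in RHS](cat_take_drop k L) count_cat.
case: (ltP 0 (nth 0 L k)) => [k0|k0].
  have -> : count (fun x => 0 < x) (take k L) = k.
    rewrite -[RHS](size_takel (ltnW kL)); apply/eqP; rewrite -all_count.
    apply/(all_nthP 0) => i; rewrite (size_takel (ltnW kL)) => ik.
    by rewrite nth_take // (lt_le_trans k0) // sorted_le // ltnW.
  by rewrite (drop_nth 0 kL) /= k0 add1n addnS ltnS leq_addr.
have -> : count (fun x => 0 < x) (drop k L) = 0%N.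
  apply/eqP; rewrite -leqn0 leqNgt -has_count; apply/hasPn => x /(nthP 0)[i iL <-].
  rewrite nth_drop -leNgt (le_trans _ k0) // sorted_le ?leq_addr //.
  by rewrite size_drop ltn_subRL in iL.
rewrite addn0; symmetry; apply/negbTE; rewrite -leqNgt (leq_trans (count_size _ _)) //.
by rewrite size_take_min geq_minl.
Qed.

(** [lambda_] is 1-based, so this is entry [(\rank C).-1]. As [C != 0], the rank is positive and the
    index lies within the list; the default of [nth] is never returned. *)
Lemma lambdar_mem : lambda_ (\rank C) (C *m C^T) \in L.
Proof. by apply: mem_nth; rewrite prednK. Qed.

Lemma lambdar_gt0 : 0 < lambda_ (\rank C) (C *m C^T).
Proof. by rewrite nth_gt0 ?prednK. Qed.

Lemma lambdar_min x : x \in L -> 0 < x -> lambda_ (\rank C) (C *m C^T) <= x.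
Proof.
move=> xL; rewrite -[x](nth_index 0 xL) nth_gt0 ?index_mem // => xr.
apply: (sorted_leq_nth ge_tr (fun x => lexx x) 0 eigs_desc_sorted).
- by rewrite inE index_mem.
- by rewrite inE prednK.
- by rewrite -ltnS prednK.
Qed.

End Eigs_desc_gram.

(** For v C C^T = s v, test the Gram matrix of [A1 A2], with blocks I, C^T, C, I, on w = (- v C, v).
    It maps w to (0, (1 - s) v), so its quadratic form at w is (1 - s) |v|^2, which full column rank
    makes positive. *)
Lemma cross_gram_eigenvalue_lt1 (R : rcfType) (m n1 n2 : nat)
  (A1 : 'M[R]_(m, n1)) (A2 : 'M[R]_(m, n2)) (C := A2^T *m A1) (s : R[i]) :
  \rank (row_mx A1 A2) = (n1 + n2)%N ->
  A1^T *m A1 = 1%:M -> A2^T *m A2 = 1%:M ->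
  eigenvalue (cmx (C *m C^T)) s -> s < 1.
Proof.
move=> rA A11 A22 /eigenvalueP[v vs v0].
pose D := map_mx (real_complex R) C.
pose w := row_mx (- (v *m D)) v.
pose A := map_mx (real_complex R) (row_mx A1 A2)^T.
have wA0 : w *m A != 0.
  apply: contraNneq v0 => wA.
  have fA : row_free A by rewrite /row_free mxrank_map mxrank_tr rA.
  have : w = 0 by apply: (row_free_inj fA); rewrite /= wA mul0mx.
  by rewrite -row_mx0 => /eq_row_mx[_ ->].
have := mulmx_ctr_gt0 _ _ _ wA0.
rewrite trmx_mul map_mxM -mulmxA (mulmxA A) /A trC_cmx trmxK -map_mxM.
rewrite tr_row_mx mul_col_row A11 A22 map_block_mx !map_mx1.
have -> : A1^T *m A2 = C^T by rewrite trmx_mul trmxK.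
rewrite -/C -/D mulmxA mul_row_block !mulmx1 addNr mulNmx -(mulmxA v) -map_mxM vs.
rewrite tr_row_mx map_col_mx mul_row_col mul0mx add0r.
have -> : - (s *: v) + v = (1 - s) *: v by rewrite scalerBl scale1r addrC.
rewrite -scalemxAl mxE.
by rewrite pmulr_lgt0 ?mulmx_ctr_gt0 // subr_gt0.
Qed.

(** * The iteration matrix in block form and its eigenvalues *)

Definition bgd_block (F : fieldType) (n1 n2 : nat)
  (C : 'M[F]_(n2, n1)) (D : 'M[F]_(n1, n2)) (g1 g2 : F) : 'M[F]_(n1 + n2) :=
  block_mx (1 - g1)%:M (- (g1 *: D))
           (- ((g2 * (1 - g1)) *: C)) ((g1 * g2) *: (C *m D) + (1 - g2)%:M).

Lemma bgd_blockE (R : rcfType) (m n1 n2 : nat)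
  (A1 : 'M[R]_(m, n1)) (A2 : 'M[R]_(m, n2)) (g1 g2 : R) :
  A1^T *m A1 = 1%:M -> A2^T *m A2 = 1%:M ->
  BGD_M A1 A2 g1 g2 = bgd_block R n1 n2 (A2^T *m A1) (A2^T *m A1)^T g1 g2.
Proof.
move=> A11 A22; rewrite /BGD_M A11 A22 /bgd_block trmx_mul trmxK.
rewrite (scalar_mx_block n1 n2 1) !opp_block_mx !add_block_mx !oppr0 !addr0 !add0r.
rewrite mulmx_block !mul0mx !addr0 !mul1mx.
have E (k : nat) (c : R) : 1%:M - c *: 1%:M = (1 - c)%:M :> 'M[R]_k.
  by rewrite scalemx1 [RHS]raddfB.
rewrite !E mulmx1; congr block_mx.
- by rewrite mulmx0 addr0 mul_mx_scalar scalerN scalerA [_ * g2]mulrC.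
- by rewrite mulmxN mulNmx opprK -scalemxAl -scalemxAr scalerA [g2 * g1]mulrC.
Qed.

(** Since [bgd_block] takes C and D separately over any field, the transpose over R can turn into
    the conjugate transpose over R[i]. *)
Lemma cmx_bgd_block (R : rcfType) (n1 n2 : nat) (C : 'M[R]_(n2, n1)) (g1 g2 : R)
  (K := map_mx (real_complex R) C) :
  cmx (bgd_block R n1 n2 C C^T g1 g2) =
  bgd_block R[i] n1 n2 K (K^t*) (g1%:C)%C (g2%:C)%C.
Proof.
rewrite /cmx map_block_mx trC_cmx map_mxD !map_mxN !map_mxZ map_mxM !map_scalar_mx.
by rewrite !(rmorphM (real_complex R)) !(rmorphB (real_complex R)) !rmorph1.
Qed.

Section Bgd_block.
Variables (K : numClosedFieldType) (n1 n2 : nat) (C : 'M[K]_(n2, n1)) (g1 g2 : K).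
Let D := C^t*.
Let a := 1 - g1.
Let b := 1 - g2.
Let M := bgd_block K n1 n2 C D g1 g2.

Let bgd_row (w1 : 'rV[K]_n1) (w2 : 'rV[K]_n2) (z : K) :
  (row_mx w1 w2 *m M == z *: row_mx w1 w2) =
  ((z - a) *: w1 == - ((g2 * a) *: (w2 *m C))) &&
  ((z - b) *: w2 == - (g1 *: (w1 *m D)) + (g1 * g2) *: (w2 *m (C *m D))).
Proof.
rewrite /M /bgd_block mul_row_block scale_row_mx.
rewrite !mul_mx_scalar mulmxDr mul_mx_scalar !mulmxN -!scalemxAr.
rewrite -/a -/b !(scalerBl z) !subr_eq addrC -addrA (eq_sym (z *: w1)) (eq_sym (z *: w2)).
by apply/eqP/andP => [/eq_row_mx[-> ->]|[/eqP <- /eqP <-]]; rewrite ?eqxx.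
Qed.

Let rank_ctr : \rank D = \rank C.
Proof. by rewrite /D mxrank_map mxrank_tr. Qed.

Lemma eigenvalue_bgd_block z : g1 != 0 -> g2 != 0 -> eigenvalue M z ->
  [\/ z = 0, z = a /\ (\rank C < n1)%N, z = b /\ (\rank C < n2)%N |
      exists s, [/\ s != 0, eigenvalue (C *m D) s &
                    (z - a) * (z - b) = g1 * g2 * s * z]].
Proof.
move=> g10 g20 /eigenvalueP[w wM w0].
have [w1 [w2 wE]] : exists w1 w2, w = row_mx w1 w2.
  by exists (lsubmx w), (rsubmx w); rewrite hsubmxK.
move: wM w0; rewrite {w}wE => /eqP; rewrite bgd_row => /andP[/eqP E1 /eqP E2] w0.
have [w20|w20] := eqVneq w2 0.
  move: w0 E1 E2; rewrite w20 !mul0mx !scaler0 oppr0 addr0 => w0 E1 E2.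
  have w10 : w1 != 0 by apply: contraNneq w0 => ->; rewrite row_mx0.
  constructor 2; split.
    by apply/eqP; move/eqP: E1; rewrite scaler_eq0 (negPf w10) orbF subr_eq0.
  rewrite -rank_ctr; apply: (ker_rank_lt _ _ _ _ w1) => //.
  apply/eqP; move/esym/eqP: E2; rewrite oppr_eq0 scaler_eq0.
  by rewrite (negPf g10).
have zw1D : (z - a) *: (w1 *m D) = - ((g2 * a) *: (w2 *m (C *m D))).
  by rewrite scalemxAl E1 mulNmx -scalemxAl -mulmxA.
(* Multiply the second eigenvector equation by z - a and eliminate w1 with the first: the
   coefficients add up to g1 g2 a + g1 g2 (z - a) = g1 g2 z. *)
have key : ((z - a) * (z - b)) *: w2 = (g1 * g2 * z) *: (w2 *m (C *m D)).
  rewrite -scalerA E2 scalerDr scalerN scalerA [_ * g1]mulrC -(scalerA g1 (z - a)) zw1D.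
  rewrite scalerN opprK !scalerA -scalerDl; congr (_ *: _); ring.
have [z0|z0] := eqVneq z 0; first by constructor 1.
pose s := (z - a) * (z - b) / (g1 * g2 * z).
have eS : w2 *m (C *m D) = s *: w2.
  by rewrite /s mulrC -scalerA key scalerA mulVf ?scale1r // !mulf_neq0.
have sE : (z - a) * (z - b) = g1 * g2 * s * z.
  by rewrite /s; field; rewrite z0 g10 g20.
have [s0|s0] := eqVneq s 0; last first.
  by constructor 4; exists s; split => //; apply/eigenvalueP; exists w2.
have w2C : w2 *m C = 0.
  by apply/eqP; rewrite -mulmx_ctr_eq0 eS s0 scale0r.
have rC2 := ker_rank_lt _ _ _ _ _ w20 w2C.
(* If z differed from b, then w2 would be a multiple of w1 D. Applying C gives w1 D C = 0, hence w1
   D = 0 and w2 = 0, a contradiction. *)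
constructor 3; split => //; apply/eqP; rewrite -subr_eq0; apply: contraTT isT => zb.
move: E2; rewrite mulmxA w2C mul0mx scaler0 addr0 => E2.
have /eqP w1D : w1 *m D == 0.
  rewrite -mulmx_ctr_eq0 /D trmxCK mulmxA; apply/eqP.
  apply: (scalerI g10); rewrite scalemxAl -[g1 *: _]opprK -E2.
  by rewrite mulNmx -scalemxAl w2C !scaler0 oppr0.
move: E2; rewrite w1D scaler0 oppr0 => /eqP.
by rewrite scaler_eq0 (negPf zb) (negPf w20).
Qed.

Lemma bgd_block_eigenvalue_root s z : z != a -> eigenvalue (C *m D) s ->
  (z - a) * (z - b) = g1 * g2 * s * z -> eigenvalue M z.
Proof.
move=> za /eigenvalueP[w2 ws w20] zE.
have za' : z - a != 0 by rewrite subr_eq0.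
(* The first component is solved from (z - a) w1 = - g2 a w2 C. *)
apply/eigenvalueP; exists (row_mx (- (g2 * a / (z - a)) *: (w2 *m C)) w2); last first.
  by apply: contraNneq w20; rewrite -row_mx0 => /eq_row_mx[_ ->].
apply/eqP; rewrite bgd_row; apply/andP; split; apply/eqP.
  by rewrite scalerA mulrN scaleNr mulrC divfK.
rewrite -scalemxAl -mulmxA ws !scalerA -scaleNr -scalerDl; congr (_ *: _).
apply: (mulfI za'); rewrite zE /a; field; exact: za'.
Qed.

Lemma bgd_block_eigenvalue_a : (\rank C < n1)%N -> eigenvalue M a.
Proof.
rewrite -rank_ctr => /ker_neq0[w w0 wD].
apply/eigenvalueP; exists (row_mx w 0); last first.
  by apply: contraNneq w0; rewrite -row_mx0 => /eq_row_mx[-> _].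
apply/eqP; rewrite bgd_row wD !mul0mx !scaler0 oppr0 addr0 subrr scale0r.
by rewrite oppr0 !eqxx.
Qed.

Lemma bgd_block_eigenvalue_b : (\rank C < n2)%N -> eigenvalue M b.
Proof.
move=> /ker_neq0[w w0 wC].
apply/eigenvalueP; exists (row_mx 0 w); last first.
  by apply: contraNneq w0; rewrite -row_mx0 => /eq_row_mx[_ ->].
apply/eqP; rewrite bgd_row mulmxA wC !mul0mx !scaler0 oppr0 addr0 subrr scale0r.
by rewrite ?oppr0 !eqxx.
Qed.
End Bgd_block.

End Conjugate_transpose.

(** * The quadratics q_s and the choice of stepsizes *)

Lemma sor_root_le (R : rcfType) (a b u s rho : R) (z : R[i]) :
  0 <= rho -> a * b = rho ^+ 2 -> `|a + b + u * s| <= 2 * rho ->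
  (z - (a%:C)%C) * (z - (b%:C)%C) = (u%:C)%C * (s%:C)%C * z ->
  `|z| <= (rho%:C)%C.
Proof.
move=> rho0; case: z => x y; rewrite ler_norml => ab /andP[t1 t2] [E1 E2].
rewrite normc_def lecR /= -[leRHS]ger0_norm // -sqrtr_sqr ler_wsqrtr //.
have {}E1 : x ^+ 2 - y ^+ 2 - (a + b + u * s) * x + rho ^+ 2 = 0.
  rewrite -ab; move: E1; rewrite !(mul0r, mulr0, oppr0, addr0, subr0) => /eqP.
  by rewrite -subr_eq0 => /eqP <-; ring.
have {}E2 : y * (2 * x - (a + b + u * s)) = 0.
  move: E2; rewrite !(mul0r, mulr0, oppr0, addr0, subr0) => /eqP.
  by rewrite -subr_eq0 => /eqP <-; ring.
move: (a + b + u * s) t1 t2 E1 E2 => t t1 t2 E1 E2.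
(* The imaginary part leaves y = 0 or 2 x = t. A real root satisfies (2 x - t)^2 = t^2 - 4 rho^2 <=
   0, so 2 x = t in both cases, and the real part becomes x^2 + y^2 = rho^2. *)
have {}E2 : 2 * x - t = 0.
  move/eqP: E2; rewrite mulf_eq0 => /orP[/eqP y0|/eqP //].
  apply/eqP; rewrite -sqrf_eq0 eq_le sqr_ge0 andbT.
  have -> : (2 * x - t) ^+ 2 = t ^+ 2 - (2 * rho) ^+ 2.
    by move: E1; rewrite y0; nra.
  by rewrite subr_le0 -subr_ge0 subr_sqr mulr_ge0 //; lra.
have tE : t = 2 * x by lra.
by move: E1; rewrite tE; nra.
Qed.

(** The value at 1 is (1 - z1) (1 - z2) for the two roots z1, z2, and each factor has modulus
    between 1 - rho and 1 + rho. For the lower estimate, 1 - rho must be nonnegative before the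
    bounds are multiplied. *)
Lemma sor_roots_value_at_1 (R : rcfType) (a b u s rho : R) :
  u = (1 - a) * (1 - b) -> 0 < u -> 0 <= rho -> s < 1 ->
  (forall z : R[i], (z - (a%:C)%C) * (z - (b%:C)%C) = (u%:C)%C * (s%:C)%C * z ->
     `|z| <= (rho%:C)%C) ->
  (rho < 1 -> (1 - rho) ^+ 2 <= u * (1 - s)) /\ u * (1 - s) <= (1 + rho) ^+ 2.
Proof.
move=> uE u0 rho0 s1 zP.
pose t := ((a + b + u * s)%:C)%C : R[i]; pose p := ((a * b)%:C)%C : R[i].
pose d := sqrtC (t ^+ 2 - 4 * p).
have dE : d ^+ 2 = t ^+ 2 - 4 * p by rewrite sqrtCK.
have tE : t = (a%:C)%C + (b%:C)%C + (u%:C)%C * (s%:C)%C by rewrite /t !(rmorphD, rmorphM).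
have pE : p = (a%:C)%C * (b%:C)%C by rewrite /p rmorphM.
pose z1 := (t + d) / 2; pose z2 := (t - d) / 2.
have prodE z : (z - z1) * (z - z2) = z ^+ 2 - t * z + p.
  transitivity (z ^+ 2 - t * z + (t ^+ 2 - d ^+ 2) / 4); first by rewrite /z1 /z2; field.
  by rewrite dE; field.
have rootE z : (z - z1) * (z - z2) = 0 -> `|z| <= (rho%:C)%C.
  rewrite prodE => E; apply: zP; apply/eqP; rewrite -subr_eq0 -E tE pE; apply/eqP; ring.
have z1P : `|z1| <= (rho%:C)%C by apply: rootE; rewrite subrr mul0r.
have z2P : `|z2| <= (rho%:C)%C by apply: rootE; rewrite subrr mulr0.
have val : (1 - z1) * (1 - z2) = ((u * (1 - s))%:C)%C.
  rewrite prodE /t /p expr1n mulr1 -[1]/((1%:C)%C) -rmorphB -rmorphD; congr (_%:C)%C.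
  by rewrite uE; ring.
have valn : `|1 - z1| * `|1 - z2| = ((u * (1 - s))%:C)%C.
  by rewrite -normrM val ger0_norm // ler0c mulr_ge0 ?ltW // subr_gt0.
have up z : `|z| <= (rho%:C)%C -> `|1 - z| <= ((1 + rho)%:C)%C.
  by move=> zr; rewrite (le_trans (ler_normB _ _)) // normr1 rmorphD lerD2l.
have lo z : `|z| <= (rho%:C)%C -> ((1 - rho)%:C)%C <= `|1 - z|.
  move=> zr; apply: le_trans (lerB_dist _ _); rewrite normr1 rmorphB.
  by rewrite lerD2l lerN2.
split=> [rho1|].
  rewrite -lecR -valn rmorphXn expr2 ler_pM ?lo // ler0c; lra.
by rewrite -lecR -valn rmorphXn expr2 ler_pM ?normr_ge0 ?up.
Qed.

(** With be^2 = 1 - s1 and al^2 = 1 - s2, u is eliminated by (1 - rho)^2 al^2 <= u be^2 al^2 <= (1 +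
    rho)^2 be^2. If rho >= 1, the quotient is at most 1 anyway. *)
Lemma sor_lower_bound (R : rcfType) (u s1 s2 rho : R) :
  0 <= rho -> s1 < 1 -> s2 <= s1 ->
  (rho < 1 -> (1 - rho) ^+ 2 <= u * (1 - s1)) -> u * (1 - s2) <= (1 + rho) ^+ 2 ->
  (Num.sqrt (1 - s2) - Num.sqrt (1 - s1)) /
  (Num.sqrt (1 - s2) + Num.sqrt (1 - s1)) <= rho.
Proof.
move=> rho0 s11 s21 lo up.
have be0 : 0 < Num.sqrt (1 - s1) by rewrite sqrtr_gt0 subr_gt0.
have al0 : 0 < Num.sqrt (1 - s2) by rewrite sqrtr_gt0 subr_gt0 (le_lt_trans s21).
have beE : Num.sqrt (1 - s1) ^+ 2 = 1 - s1 by rewrite sqr_sqrtr // subr_ge0 ltW.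
have alE : Num.sqrt (1 - s2) ^+ 2 = 1 - s2.
  by rewrite sqr_sqrtr // subr_ge0 ltW // (le_lt_trans s21).
move: (Num.sqrt (1 - s1)) (Num.sqrt (1 - s2)) be0 al0 beE alE => be al be0 al0 beE alE.
rewrite -beE in lo; rewrite -alE in up.
rewrite ler_pdivrMr ?addr_gt0 //.
have [rho1|rho1] := leP 1 rho; first by nra.
have {}lo := lo rho1.
suff : (1 - rho) * al <= (1 + rho) * be by move=> H; nra.
rewrite -(ler_pXn2r (n := 2)) // ?nnegrE; [|nra|nra].
rewrite !exprMn.
apply: le_trans (_ : u * be ^+ 2 * al ^+ 2 <= _); first by rewrite ler_wpM2r ?sqr_ge0.
by rewrite mulrAC ler_wpM2r ?sqr_ge0.
Qed.

Lemma sor_optimal_stepsizes (R : rcfType) (al be : R)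
  (rho := (al - be) / (al + be)) (u := 4 / (al + be) ^+ 2) :
  0 < be -> be <= al -> al <= 1 ->
  exists g h, [/\ 0 < g, 0 < h, g * h = u, (1 - g) * (1 - h) = rho ^+ 2 &
                  `|1 - g| <= rho].
Proof.
move=> be0 ba al1.
have S0 : 0 < al + be by lra.
have rho0 : 0 <= rho by rewrite divr_ge0 //; lra.
have u0 : 0 < u by rewrite divr_gt0 // exprn_gt0.
have uE : u * al ^+ 2 = (1 + rho) ^+ 2 by rewrite /u /rho; field; lra.
have rho1 : rho < 1 by rewrite /rho ltr_pdivrMr // mul1r; lra.
have u_ge : (1 + rho) ^+ 2 <= u.
  have al2 : al ^+ 2 <= 1 by apply: exprn_ile1 => //; lra.
  by rewrite -uE -[leRHS]mulr1 ler_wpM2l // ltW.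
clearbody rho u.
(* Prescribing g h = u and (1 - g) (1 - h) = rho^2 forces g + h = G, so g and h are the roots of X^2
   - G X + u. The discriminant is nonnegative because al <= 1 gives u >= (1 + rho)^2. *)
pose G := 1 - rho ^+ 2 + u.
have G0 : 0 < G by rewrite /G; nra.
have D0 : 0 <= G ^+ 2 - 4 * u.
  have -> : G ^+ 2 - 4 * u = (u - (1 + rho) ^+ 2) * (u - (1 - rho) ^+ 2) by rewrite /G; ring.
  by apply: mulr_ge0; nra.
pose d := Num.sqrt (G ^+ 2 - 4 * u).
have dE : d ^+ 2 = G ^+ 2 - 4 * u by rewrite sqr_sqrtr.
have d0 : 0 <= d by rewrite sqrtr_ge0.
have dG : d < G.
  rewrite ltNge; apply/negP => Gd.
  by move: (ler_pM (ltW G0) (ltW G0) Gd Gd); rewrite -(expr2 d) dE; lra.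
pose g := (G + d) / 2; pose h := (G - d) / 2.
have g0 : 0 < g by rewrite divr_gt0 //; lra.
have h0 : 0 < h by rewrite divr_gt0 //; lra.
have gh : g * h = u.
  transitivity ((G ^+ 2 - d ^+ 2) / 4); first by rewrite /g /h; field.
  by rewrite dE; field.
have gDh : g + h = G by rewrite /g /h; field.
have ab : (1 - g) * (1 - h) = rho ^+ 2.
  transitivity (1 - (g + h) + g * h); first by ring.
  by rewrite gDh gh /G; ring.
(* The moduli of 1 - g and 1 - h multiply to rho^2, so they cannot both exceed rho; swap the roots
   if needed. *)
have [gr|gr] := leP `|1 - g| rho; first by exists g, h.
exists h, g; split => //; rewrite 1?mulrC //.
rewrite leNgt; apply/negP => hr.
suff : rho ^+ 2 < `|1 - g| * `|1 - h| by rewrite -normrM ab ger0_norm ?sqr_ge0 // ltxx.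
by rewrite expr2 ltr_pM.
Qed.

(** The sum equals 1 + rho^2 - u (1 - s) with u = g h, and u (1 - s) lies between u be^2 = (1 -
    rho)^2 and u al^2 = (1 + rho)^2. *)
Lemma sor_trace_bound (R : rcfType) (al be g h s : R)
  (rho := (al - be) / (al + be)) :
  0 < be -> be <= al -> be ^+ 2 <= 1 - s <= al ^+ 2 ->
  g * h = 4 / (al + be) ^+ 2 -> (1 - g) * (1 - h) = rho ^+ 2 ->
  `|(1 - g) + (1 - h) + g * h * s| <= 2 * rho.
Proof.
move=> be0 ba /andP[s1 s2] gh ab.
have S0 : 0 < al + be by lra.
have uA : g * h * al ^+ 2 = (1 + rho) ^+ 2 by rewrite gh /rho; field; lra.
have uB : g * h * be ^+ 2 = (1 - rho) ^+ 2 by rewrite gh /rho; field; lra.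
have u0 : 0 <= g * h by rewrite gh divr_ge0 // sqr_ge0.
have -> : (1 - g) + (1 - h) + g * h * s = 1 + rho ^+ 2 - g * h * (1 - s).
  by rewrite -ab; ring.
have := ler_wpM2l u0 s1; have := ler_wpM2l u0 s2; rewrite uA uB.
clearbody rho; move: (g * h * (1 - s)) => t t1 t2.
by rewrite ler_norml; apply/andP; split; lra.
Qed.

(** * Bounds on the spectral radius of the iteration matrix *)

Section Two_block.
Variables (R : rcfType) (m n1 n2 : nat) (A1 : 'M[R]_(m, n1)) (A2 : 'M[R]_(m, n2)).
Hypothesis rkA : \rank (row_mx A1 A2) = (n1 + n2)%N.
Hypothesis A11 : A1^T *m A1 = 1%:M.
Hypothesis A22 : A2^T *m A2 = 1%:M.
Let C := A2^T *m A1.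
Let L := eigs_desc (C *m C^T).
Let l1 := lambda_ 1 (C *m C^T).
Let rho g1 g2 := spectral_radius (BGD_M A1 A2 g1 g2).
Hypothesis C0 : C != 0.

Lemma cross_gram_eigs_lt1 x : x \in L -> x < 1.
Proof.
rewrite mem_eigs_desc_gram -ltcR.
exact: cross_gram_eigenvalue_lt1 rkA A11 A22.
Qed.

Lemma lambda1_gt0 : 0 < l1.
Proof.
apply: lt_le_trans (lambdar_gt0 _ _ _ _ C0) _.
exact: lambda1_max _ _ _ _ C0 _ (lambdar_mem _ _ _ _ C0).
Qed.

Let rankE : \rank (map_mx (real_complex R) C) = \rank C.
Proof. by rewrite mxrank_map. Qed.

Let cmx_BGD g1 g2 : cmx (BGD_M A1 A2 g1 g2) =
  let K := map_mx (real_complex R) C in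
  bgd_block R[i] n1 n2 K (map_mx Num.conj K^T) (g1%:C)%C (g2%:C)%C.
Proof. by rewrite bgd_blockE // cmx_bgd_block. Qed.

Lemma BGD_root_le g1 g2 x : x \in L -> 0 < x -> 0 < g1 -> 0 < g2 ->
  forall z : R[i], (z - ((1 - g1)%:C)%C) * (z - ((1 - g2)%:C)%C) =
    ((g1 * g2)%:C)%C * (x%:C)%C * z -> `|z| <= ((rho g1 g2)%:C)%C.
Proof.
move=> xL x0 g10 g20 z zE.
have [za|za] := eqVneq z ((1 - g1)%:C)%C.
  (* At z = a the eigenvector construction would divide by zero, but the equation then forces z =
     0. *)
  have /eqP : ((g1 * g2)%:C)%C * (x%:C)%C * z = 0 by rewrite -zE za subrr mul0r.
  rewrite -rmorphM mulf_eq0 fmorph_eq0 (gt_eqF (mulr_gt0 (mulr_gt0 g10 g20) x0)) /= => /eqP->.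
  by rewrite normr0 ler0c spectral_radius_ge0.
apply: spectral_radius_ge; rewrite cmx_BGD.
apply: (bgd_block_eigenvalue_root _ _ _ _ _ _ (x%:C)%C).
- by move: za; rewrite rmorphB rmorph1.
- by rewrite -cmx_gram -mem_eigs_desc_gram.
- by move: zE; rewrite !(rmorphB (real_complex R)) !rmorph1 rmorphM.
Qed.

(** The disjunction serves both rank cases. For slo = 0 the roots of q_0 are a and b, which are
    eigenvalues because both ranks are deficient. *)
Lemma BGD_lower_bound slo g1 g2 :
  (slo \in L) && (0 < slo) || [&& slo == 0, (\rank C < n1)%N & (\rank C < n2)%N] ->
  0 < g1 -> 0 < g2 ->
  (Num.sqrt (1 - slo) - Num.sqrt (1 - l1)) /
  (Num.sqrt (1 - slo) + Num.sqrt (1 - l1)) <= rho g1 g2.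
Proof.
move=> sloP g10 g20.
have uE : g1 * g2 = (1 - (1 - g1)) * (1 - (1 - g2)) by ring.
have u0 : 0 < g1 * g2 by rewrite mulr_gt0.
have l1L : l1 \in L by apply: lambda1_mem.
have rho0 : 0 <= rho g1 g2 by apply: spectral_radius_ge0.
have slo_l1 : slo <= l1.
  case/orP: sloP => [/andP[sL _]|/and3P[/eqP-> _ _]]; first exact: lambda1_max.
  exact: ltW lambda1_gt0.
have l11 := cross_gram_eigs_lt1 _ l1L.
have [lo _] := sor_roots_value_at_1 _ _ _ _ l1 _ uE u0 rho0 l11
  (BGD_root_le _ _ _ l1L lambda1_gt0 g10 g20).
suff sloR : forall z : R[i], (z - ((1 - g1)%:C)%C) * (z - ((1 - g2)%:C)%C) =
    ((g1 * g2)%:C)%C * (slo%:C)%C * z -> `|z| <= ((rho g1 g2)%:C)%C.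
  have [_ up] := sor_roots_value_at_1 _ _ _ _ slo _ uE u0 rho0 (le_lt_trans slo_l1 l11) sloR.
  exact: sor_lower_bound rho0 l11 slo_l1 lo up.
case/orP: sloP => [/andP[sL s0]|/and3P[/eqP-> r1 r2]]; first exact: BGD_root_le.
move=> z; rewrite mulr0 mul0r => /eqP; rewrite mulf_eq0 !subr_eq0.
rewrite !(rmorphB (real_complex R)) rmorph1 => /orP[] /eqP->;
  apply: spectral_radius_ge; rewrite cmx_BGD.
- by apply: bgd_block_eigenvalue_a; rewrite rankE.
- by apply: bgd_block_eigenvalue_b; rewrite rankE.
Qed.

(** [al] stands for sqrt (1 - lr) at full rank and for 1 otherwise. The diagonal values 1 - g and 1
    - h need a bound only where the corresponding block is rank deficient. *)
Lemma BGD_upper_bound al g h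
  (be := Num.sqrt (1 - l1)) (v := (al - be) / (al + be)) :
  be <= al -> {in L, forall x, 0 < x -> 1 - x <= al ^+ 2} ->
  0 < g -> 0 < h -> g * h = 4 / (al + be) ^+ 2 ->
  (1 - g) * (1 - h) = v ^+ 2 ->
  ((\rank C < n1)%N -> `|1 - g| <= v) -> ((\rank C < n2)%N -> `|1 - h| <= v) ->
  rho g h <= v.
Proof.
move=> ba xal g0 h0 gh ab ga hb.
have l11 := cross_gram_eigs_lt1 _ (lambda1_mem _ _ _ _ C0).
have be0 : 0 < be by rewrite sqrtr_gt0 subr_gt0.
have v0 : 0 <= v by rewrite divr_ge0 //; lra.
apply: spectral_radius_le => // z; rewrite cmx_BGD => /eigenvalue_bgd_block.
rewrite !fmorph_eq0 !gt_eqF // rankE => /(_ isT isT)[->|[-> r1]|[-> r2]|[s [s0 sE zE]]].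
- by rewrite normr0 ler0c.
- by rewrite -[1]/((1%:C)%C) -rmorphB normc_def /= expr0n addr0 sqrtr_sqr lecR ga.
- by rewrite -[1]/((1%:C)%C) -rmorphB normc_def /= expr0n addr0 sqrtr_sqr lecR hb.
rewrite -cmx_gram in sE.
have sge := gram_eigenvalue_ge0 _ _ _ _ _ sE.
have [x sx] := complex_realP _ (ger0_real sge); subst s.
have xL : x \in L by rewrite mem_eigs_desc_gram.
have x0 : 0 < x by rewrite lt_neqAle eq_sym -(fmorph_eq0 (real_complex R)) s0 -ler0c.
apply: (sor_root_le _ (1 - g) (1 - h) (g * h) x) => //.
- apply: sor_trace_bound => //; rewrite xal // andbT.
  rewrite sqr_sqrtr ?subr_ge0 ?(ltW l11) // lerD2l lerN2.
  exact: lambda1_max.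
- by rewrite !(rmorphB (real_complex R)) rmorph1 (rmorphM (real_complex R)).
Qed.

End Two_block.

Theorem theorem2 (R : rcfType) (m n1 n2 : nat)
  (A1 : 'M[R]_(m, n1)) (A2 : 'M[R]_(m, n2)) :
  \rank (row_mx A1 A2) = (n1 + n2)%N ->
  A1^T *m A1 = 1%:M ->
  A2^T *m A2 = 1%:M ->
  A2^T *m A1 != 0 ->
  let C := A2^T *m A1 in
  let r := \rank C in
  let l1 := lambda_ 1 (C *m C^T) in
  let lr := lambda_ r (C *m C^T) in
  let rho := fun g1 g2 => spectral_radius (BGD_M A1 A2 g1 g2) in
  ((r = minn n1 n2) ->
     is_min_pos rho
       ((Num.sqrt (1 - lr) - Num.sqrt (1 - l1)) /
        (Num.sqrt (1 - lr) + Num.sqrt (1 - l1)))) /\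
  ((r < minn n1 n2)%N ->
     is_min_pos rho ((1 - Num.sqrt (1 - l1)) / (1 + Num.sqrt (1 - l1))) /\
     rho (2 / (1 + Num.sqrt (1 - l1))) (2 / (1 + Num.sqrt (1 - l1)))
       = (1 - Num.sqrt (1 - l1)) / (1 + Num.sqrt (1 - l1))).
Proof.
move=> rkA A11 A22 C0 C r l1 lr rho.
have lt1 := cross_gram_eigs_lt1 _ _ _ _ _ _ rkA A11 A22.
have lrL : lr \in _ := lambdar_mem _ _ _ _ C0.
have lr0 : 0 < lr := lambdar_gt0 _ _ _ _ C0.
have l1L : l1 \in _ := lambda1_mem _ _ _ _ C0.
have lr_l1 : lr <= l1 := lambda1_max _ _ _ _ C0 _ lrL.
have be0 : 0 < Num.sqrt (1 - l1) by rewrite sqrtr_gt0 subr_gt0 lt1.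
have lower := BGD_lower_bound _ _ _ _ _ _ rkA A11 A22 C0.
have upper := BGD_upper_bound _ _ _ _ _ _ rkA A11 A22 C0.
split=> [rE|].
  have low g1 g2 := lower lr g1 g2.
  split; last by move=> g1 g2 g10 g20; apply: low => //; rewrite lrL lr0.
  have ba : Num.sqrt (1 - l1) <= Num.sqrt (1 - lr) by rewrite ler_wsqrtr // lerD2l lerN2.
  have al1 : Num.sqrt (1 - lr) <= 1.
    by rewrite -[leRHS]sqrtr1 ler_wsqrtr // gerBl ltW.
  have xal : {in eigs_desc (C *m C^T), forall x, 0 < x -> 1 - x <= Num.sqrt (1 - lr) ^+ 2}.
    move=> x xL x0; rewrite sqr_sqrtr ?subr_ge0 ?(ltW (lt1 _ lrL)) // lerD2l lerN2.
    exact: lambdar_min.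
  have [g [h [g0 h0 gh ab ga]]] := sor_optimal_stepsizes _ _ _ be0 ba al1.
  (* Only the larger block can be rank deficient, so it receives the stepsize g, for which the
     modulus of 1 - g is controlled. *)
  have [n12|n12] := leqP n1 n2.
    exists h, g; split => //; split => //; apply: le_anti.
    rewrite low ?lrL ?lr0 // andbT upper // 1?[h * g]mulrC 1?[(1 - h) * _]mulrC //.
    by rewrite -/C -/r rE (minn_idPl n12) ltnn.
  exists g, h; split => //; split => //; apply: le_anti.
  rewrite low ?lrL ?lr0 // andbT upper //.
  by rewrite -/C -/r rE (minn_idPr (ltnW n12)) ltnn.
rewrite leq_min => /andP[r1 r2].
have low g1 g2 : 0 < g1 -> 0 < g2 ->
    (1 - Num.sqrt (1 - l1)) / (1 + Num.sqrt (1 - l1)) <= rho g1 g2.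
  (* Rank deficiency allows slo = 0, which turns sqrt (1 - slo) into 1. *)
  by move=> g10 g20; have := lower 0 g1 g2; rewrite subr0 sqrtr1 eqxx r1 r2 orbT => ->.
pose om := 2 / (1 + Num.sqrt (1 - l1)).
have om0 : 0 < om by rewrite divr_gt0 // addr_gt0.
have be1 : Num.sqrt (1 - l1) <= 1.
  by rewrite -[leRHS]sqrtr1 ler_wsqrtr // gerBl (le_trans (ltW lr0)).
have omE : rho om om = (1 - Num.sqrt (1 - l1)) / (1 + Num.sqrt (1 - l1)).
  have bn : 1 + Num.sqrt (1 - l1) != 0 by rewrite gt_eqF // addr_gt0.
  have om1 : 1 - om = - ((1 - Num.sqrt (1 - l1)) / (1 + Num.sqrt (1 - l1))).
    by rewrite /om; field.
  have om2 : `|1 - om| <= (1 - Num.sqrt (1 - l1)) / (1 + Num.sqrt (1 - l1)).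
    by rewrite om1 normrN ger0_norm // divr_ge0 ?subr_ge0 // addr_ge0 // sqrtr_ge0.
  (* The upper bound is used with [al] equal to 1, where 1 - x <= al^2 follows from x > 0. *)
  apply: le_anti; rewrite low // andbT upper //.
  - by move=> x _ x0; rewrite expr1n gerBl ltW.
  - by rewrite /om; field.
  - by rewrite om1 mulrNN expr2.
split=> //; split; last exact: low.
by exists om, om.
Qed.
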